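(* Let $$\kappa=\min\Big\{\frac{S^{\text{min}}}{E^{\text{max}}},\ \frac{S^{\text{max}}-S^{\text{min}}}{E^{\text{max}}}\Big\},$$ let $\lambda\ge 0$ be a fixed constant, and for $\gamma>0$ consider the problem $$\max_{S_i,E_i}\Big\{\gamma\cdot(S_2-\kappa E_2)+\sum_{i=1}^{2}\big(S_i-\lambda\, W(S_i,E_i)\big) : (S_i,E_i)\in\mathcal{O},\ i=1,2\Big\}.$$ The maximizers converge: $$\lim_{\gamma\to\infty}\underline{S}_2^*(\gamma)=\lim_{\gamma\to\infty}\overline{S}_2^*(\gamma)=S^{\text{max}},\qquad \lim_{\gamma\to\infty}\underline{E}_2^*(\gamma)=\lim_{\gamma\to\infty}\overline{E}_2^*(\gamma)=E^{\text{opt}}.$$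
   Context: Superscripts are labels, not powers; subscripts $1,2$ denote time periods. $\mathcal{O}\subset\mathbb{R}^2$ (the set of feasible operating points $(S,E)$, where $S$ is satisfaction and $E$ is energy usage) is a compact, possibly nonconvex, polygonal region. $S^{\text{min}},S^{\text{max}}$ and $E^{\text{min}},E^{\text{max}}$ are the minimum and maximum of the $S$- and $E$-coordinates over $\mathcal{O}$. The points $(S^{\text{min}},E^{\text{min}})$, $(S^{\text{max}},E^{\text{opt}})$, $(S^{\text{max}},E^3)$, $(S^4,E^{\text{max}})$ form the right boundary of $\mathcal{O}$: the polygonal chain joining them successively by straight segments is contained in $\mathcal{O}$, and for each $E\in[E^{\text{min}},E^{\text{max}}]$ the largest $S$ with $(S,E)\in\mathcal{O}$ is the $S$-coordinate of the point on this chain at height $E$. Here $S^{\text{min}}<S^{\text{max}}$, $S^4<S^{\text{max}}$ and $E^{\text{min}}<E^{\text{opt}}\le E^3<E^{\text{max}}$. With $m=(E^{\text{opt}}-E^{\text{min}})/(S^{\text{max}}-S^{\text{min}})$, one has $0<\kappa<1/m$ in the model. The work function $W:\mathcal{O}\to[0,1]$ is continuous. It has exactly two global minimizers $(S^\alpha,E^\alpha),(S^\omega,E^\omega)\in\mathrm{int}(\mathcal{O})$ (at which its values are equal), with $S^\alpha<S^\omega$ and $E^\alpha<E^\omega$. $S_2^*(\gamma)$ and $E_2^*(\gamma)$ are the projections of the set of maximizers of the problem onto the $S_2$- and $E_2$-components; overlines and underlines denote the maximum and minimum of these sets. *)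

(* Defs.v *)
From HB Require Import structures.
From mathcomp Require Import all_boot all_order all_algebra.
From mathcomp Require Import all_classical all_reals all_analysis.
Set Implicit Arguments.
Unset Strict Implicit.
Unset Printing Implicit Defensive.
Import Order.TTheory GRing.Theory Num.Theory.
Import numFieldNormedType.Exports.
Local Open Scope classical_set_scope.
Local Open Scope ring_scope.

(* Points of the plane are pairs p = (S, E) : R * R. *)

Definition is_minimum (R : realType) (A : set R) (x : R) : Prop :=
  A x /\ forall y, A y -> x <= y.

Definition is_maximum (R : realType) (A : set R) (x : R) : Prop :=
  A x /\ forall y, A y -> y <= x.

Definition argmin_on (R : realType) (T : Type) (D : set T) (f : T -> R) :
    set T :=
  [set x | D x /\ forall y, D y -> f x <= f y].

Definition argmax_on (R : realType) (T : Type) (D : set T) (f : T -> R) :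
    set T :=
  [set x | D x /\ forall y, D y -> f y <= f x].

Definition segment (R : realType) (p q : R * R) : set (R * R) :=
  [set (line_path p.1 q.1 t, line_path p.2 q.2 t) | t in `[0, 1]].

Definition triangle (R : realType) (a b c : R * R) : set (R * R) :=
  [set p | exists u v w : R,
     [/\ 0 <= u, 0 <= v, 0 <= w, u + v + w = 1 &
         p = (u * a.1 + v * b.1 + w * c.1, u * a.2 + v * b.2 + w * c.2)]].

Definition noncollinear (R : realType) (a b c : R * R) : Prop :=
  (b.1 - a.1) * (c.2 - a.2) - (b.2 - a.2) * (c.1 - a.1) != 0.

(* A finite union of nondegenerate closed triangles: nonconvex regions and
   regions with holes are allowed.  Triangles may overlap, which gives the same
   sets as triangulations. *)
Definition polygonal_region (R : realType) (O : set (R * R)) : Prop :=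
  exists (n : nat) (a b c : 'I_n -> R * R),
    (forall i, noncollinear (a i) (b i) (c i)) /\
    O = \bigcup_i triangle (a i) (b i) (c i).

Definition chain4 (R : realType) (p1 p2 p3 p4 : R * R) : set (R * R) :=
  segment p1 p2 `|` segment p2 p3 `|` segment p3 p4.

Definition right_boundary (R : realType) (O : set (R * R)) (Emin Emax : R)
    (C : set (R * R)) : Prop :=
  C `<=` O /\
  forall E, Emin <= E <= Emax ->
    forall S, C (S, E) -> is_maximum [set S' | O (S', E)] S.

(* The decision variable is x = (x_1, x_2) with x_i = (S_i, E_i). *)
Definition objective (R : realType) (W : R * R -> R) (lambda kappa gamma : R)
    (x : (R * R) * (R * R)) : R :=
  gamma * (x.2.1 - kappa * x.2.2)
  + ((x.1.1 - lambda * W x.1) + (x.2.1 - lambda * W x.2)).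

Definition maximizers (R : realType) (O : set (R * R)) (W : R * R -> R)
    (lambda kappa gamma : R) : set ((R * R) * (R * R)) :=
  argmax_on (O `*` O) (objective W lambda kappa gamma).

Definition S2_star (R : realType) (O : set (R * R)) (W : R * R -> R)
    (lambda kappa gamma : R) : set R :=
  [set x.2.1 | x in maximizers O W lambda kappa gamma].

Definition E2_star (R : realType) (O : set (R * R)) (W : R * R -> R)
    (lambda kappa gamma : R) : set R :=
  [set x.2.2 | x in maximizers O W lambda kappa gamma].

(* Main.v *)
(* Since kappa lies strictly between 0 and the inverse slope 1/m of the lower
   segment of the right boundary, the linear functional S - kappa E has a sharp
   maximum over O at (Smax, Eopt): leaving this point costs at least a fixed
   multiple of the distance.  The remaining period-2 terms of the objective vary
   in the unfavourable direction by at most lambda, so every maximizer satisfies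
   |S_2 - Smax|, |E_2 - Eopt| <= lambda / (c gamma). *)
Require Import Defs.
From HB Require Import structures.
From mathcomp Require Import all_boot all_order all_algebra.
From mathcomp Require Import all_classical all_reals all_analysis.
From mathcomp Require Import ring lra.
Import Order.TTheory GRing.Theory Num.Theory.
Import numFieldNormedType.Exports.
Local Open Scope classical_set_scope.
Local Open Scope ring_scope.

Lemma is_minimum_inf (R : realType) (A : set R) (x : R) :
  is_minimum A x -> is_minimum A (inf A).
Proof.
move=> [Ax lbx]; suff -> : inf A = x by [].
apply/eqP; rewrite eq_le; apply/andP; split.
- by apply: ge_inf Ax; exists x.
- by apply: lb_le_inf => //; exists x.
Qed.

Lemma is_maximum_sup (R : realType) (A : set R) (x : R) :
  is_maximum A x -> is_maximum A (sup A).
Proof.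
move=> [Ax ubx]; suff -> : sup A = x by [].
apply/eqP; rewrite eq_le; apply/andP; split.
- by apply: ge_sup => //; exists x.
- by apply: ub_le_sup Ax; exists x.
Qed.

(** A continuous image of a nonempty compact set attains its bounds, so the total functions [inf]
    and [sup] return genuine extrema. The intended [g] are the two period-2 coordinates on the set
    of maximizers. *)
Lemma compact_image_inf (R : realType) (T : topologicalType) (K : set T)
    (g : T -> R) :
  compact K -> K !=set0 -> continuous g ->
  is_minimum (g @` K) (inf (g @` K)).
Proof.
move=> cK K0 cg.
have [x /set_mem Kx xmin] :=
  compact_EVT_min K0 cK (continuous_subspaceT cg).
apply: (@is_minimum_inf _ _ (g x)); split; first by exists x.
by move=> _ [y Ky <-]; apply: xmin; exact: mem_set.
Qed.

Lemma compact_image_sup (R : realType) (T : topologicalType) (K : set T)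
    (g : T -> R) :
  compact K -> K !=set0 -> continuous g ->
  is_maximum (g @` K) (sup (g @` K)).
Proof.
move=> cK K0 cg.
have [x /set_mem Kx xmax] :=
  compact_EVT_max K0 cK (continuous_subspaceT cg).
apply: (@is_maximum_sup _ _ (g x)); split; first by exists x.
by move=> _ [y Ky <-]; apply: xmax; exact: mem_set.
Qed.

(** Once one maximizer [x] exists, the argmax is the superlevel set of [f] at height [f x] inside
    [K], hence a closed part of a compact set. *)
Lemma argmax_on_compact (R : realType) (T : topologicalType) (K : set T)
    (f : T -> R) :
  closed K -> compact K -> K !=set0 -> {within K, continuous f} ->
  compact (argmax_on K f) /\ argmax_on K f !=set0.
Proof.
move=> clK cK K0 cf.
have [x /set_mem Kx xmax] := compact_EVT_max K0 cK cf.
have {}xmax y : K y -> f y <= f x by move=> Ky; apply: xmax; exact: mem_set.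
split; last by exists x.
have -> : argmax_on K f = f @^-1` [set r | f x <= r] `&` K.
  apply/seteqP; split=> [y [Ky ymax]|y [/= fxy Ky]].
    by split=> //=; exact: ymax.
  by split=> // z Kz; exact: le_trans (xmax z Kz) fxy.
apply: subclosed_compact cK _; last by move=> y [].
(* Continuity within [K] makes the preimage closed for the subspace topology only; closedness of [K]
   carries this over to the ambient space. *)
rewrite (closed_setIS (f @^-1` [set r | f x <= r]) clK).
move/continuous_closedP: cf; apply; exact: closed_ge.
Qed.

Lemma objective_continuous (R : realType) (O : set (R * R)) (W : R * R -> R)
    (lambda kappa gamma : R) :
  {within O, continuous W} ->
  {within O `*` O, continuous (objective W lambda kappa gamma)}.
Proof.
move=> /subspace_continuousP cW; apply/subspace_continuousP => x [Ox1 Ox2].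
set F := within _ _.
have idF : y @[y --> F] --> x by exact: cvg_within.
have c1 : y.1 @[y --> F] --> x.1 by apply: cvg_comp idF _; exact: cvg_fst.
have c2 : y.2 @[y --> F] --> x.2 by apply: cvg_comp idF _; exact: cvg_snd.
have c11 : y.1.1 @[y --> F] --> x.1.1 by apply: cvg_comp c1 _; exact: cvg_fst.
have c21 : y.2.1 @[y --> F] --> x.2.1 by apply: cvg_comp c2 _; exact: cvg_fst.
have c22 : y.2.2 @[y --> F] --> x.2.2 by apply: cvg_comp c2 _; exact: cvg_snd.
(* [W] is continuous only within [O], so the limit of [y.1] has to be taken through points of [O];
   along [F] both components stay there. *)
have w1 : W y.1 @[y --> F] --> W x.1.
  apply: cvg_comp (cW _ Ox1) => U /c1; apply: filterS2 (withinT _ _) => y OOy.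
  by apply; exact: OOy.1.
have w2 : W y.2 @[y --> F] --> W x.2.
  apply: cvg_comp (cW _ Ox2) => U /c2; apply: filterS2 (withinT _ _) => y OOy.
  by apply; exact: OOy.2.
rewrite /objective; apply: cvgD.
  by apply: cvgMr; apply: cvgB => //; exact: cvgMr.
by apply: cvgD; apply: cvgB => //; exact: cvgMr.
Qed.

(** Every element of [A gamma] is within [C / gamma] of [l], so any selection [u] converges to [l],
    in particular the smallest and the largest element. *)
Lemma cvg_pinfty_squeeze_inv (R : realType) (A : R -> set R) (u : R -> R)
    (l C : R) :
  (forall gamma, 0 < gamma -> A gamma (u gamma)) ->
  (forall gamma x, 0 < gamma -> A gamma x -> gamma * `|l - x| <= C) ->
  u gamma @[gamma --> +oo] --> l.
Proof.
move=> Au Abound; apply/cvgrPdist_lt => e e0; near=> gamma.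
have g0 : 0 < gamma by near: gamma; apply: nbhs_pinfty_gt; exact: num_real.
rewrite -(ltr_pM2l g0); apply: le_lt_trans (Abound _ _ g0 (Au _ g0)) _.
(* The threshold is [C / e]: beyond it, [C < gamma * e]. *)
rewrite -ltr_pdivrMr //.
by near: gamma; apply: nbhs_pinfty_gt; exact: num_real.
Unshelve. all: by end_near. Qed.

(** At heights between [Emin] and [Eopt] the right boundary is the segment of slope [m], and [p]
    lies to its left. This is [Eopt - E <= m * (Smax - S)] cleared of denominators. *)
Lemma right_boundary_lower (R : realType) (O : set (R * R))
    (Smin Smax S4 Emin Emax Eopt E3 : R) (p : R * R) :
  right_boundary O Emin Emax
    (chain4 (Smin, Emin) (Smax, Eopt) (Smax, E3) (S4, Emax)) ->
  Emin < Eopt -> Eopt <= Emax -> O p -> Emin <= p.2 <= Eopt ->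
  (Eopt - p.2) * (Smax - Smin) <= (Eopt - Emin) * (Smax - p.1).
Proof.
case: p => S E [_ bdO] ltEminopt leEoptmax OSE /= /andP[leE1 leE2].
have h0 : 0 < Eopt - Emin by rewrite subr_gt0.
(* The parameter at which the lower segment reaches height [E]. *)
pose t := (E - Emin) / (Eopt - Emin).
have tE : t * (Eopt - Emin) = E - Emin by rewrite /t divfK ?gt_eqF.
have inC : chain4 (Smin, Emin) (Smax, Eopt) (Smax, E3) (S4, Emax)
    (line_path Smin Smax t, E).
  left; left; exists t => /=.
    by rewrite in_itv /= divr_ge0 ?ler_pdivrMr ?mul1r //; lra.
  by congr pair; rewrite /line_path; lra.
have Eb : Emin <= E <= Emax by rewrite leE1 (le_trans leE2).
have [_ /(_ S OSE)] := bdO E Eb _ inC.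
rewrite /line_path -(ler_pM2l h0) => leS.
have -> : (Eopt - E) * (Smax - Smin)
    = (Eopt - Emin - t * (Eopt - Emin)) * (Smax - Smin) by rewrite tE; ring.
lra.
Qed.

(** With [x = Smax - S >= 0] and [y = Eopt - E], the loss is [x - kappa * y]. If [y >= 0], then
    [y <= m * x] and the loss is at least [(1 - kappa * m) * x]; if [y < 0], the loss is
    [x + kappa * |y|]. In both cases it dominates a multiple of [x] and of [|y|]. *)
Lemma sharp_maximum (R : realType) (O : set (R * R))
    (Smin Smax S4 Emin Emax Eopt E3 kappa : R) :
  is_maximum [set p.1 | p in O] Smax ->
  is_minimum [set p.2 | p in O] Emin ->
  right_boundary O Emin Emax
    (chain4 (Smin, Emin) (Smax, Eopt) (Smax, E3) (S4, Emax)) ->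
  Smin < Smax -> Emin < Eopt -> Eopt <= Emax ->
  0 < kappa -> kappa < 1 / ((Eopt - Emin) / (Smax - Smin)) ->
  exists2 c : R, 0 < c & forall p, O p ->
    c * `|Smax - p.1| <= (Smax - kappa * Eopt) - (p.1 - kappa * p.2) /\
    c * `|Eopt - p.2| <= (Smax - kappa * Eopt) - (p.1 - kappa * p.2).
Proof.
move=> [_ maxS] [_ minE] bdO ltS ltE leE k0.
set m := (Eopt - Emin) / (Smax - Smin) => km.
have m0 : 0 < m by rewrite divr_gt0 ?subr_gt0.
have mE : m * (Smax - Smin) = Eopt - Emin by rewrite divfK // gt_eqF ?subr_gt0.
have c00 : 0 < 1 - kappa * m by rewrite subr_gt0 -ltr_pdivlMr.
set c0 := 1 - kappa * m in c00.
(* The three entries bound, in order, the [S]-distance, the [E]-distance below [Eopt] (through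
   [y <= m * x]), and the [E]-distance above [Eopt]. *)
pose c := Num.min (Num.min c0 (c0 / m)) kappa.
have c_gt0 : 0 < c by rewrite !lt_min c00 divr_gt0.
have cc0 : c <= c0 by rewrite !ge_min lexx.
have ccm : c * m <= c0 by rewrite -ler_pdivlMr // !ge_min lexx orbT.
have ck : c <= kappa by rewrite !ge_min lexx !orbT.
have c1 : c0 <= 1 by rewrite gerBl mulr_ge0 ?ltW.
exists c => // -[S E] OSE /=.
have x0 : 0 <= Smax - S by rewrite subr_ge0; apply: maxS; exists (S, E).
have E0 : Emin <= E by apply: minE; exists (S, E).
rewrite (ger0_norm x0).
have cx : c * (Smax - S) <= c0 * (Smax - S) by rewrite ler_wpM2r.
case: (leP E Eopt) => EE.
  have y0 : 0 <= Eopt - E by rewrite subr_ge0.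
  have yx : Eopt - E <= m * (Smax - S).
    have := right_boundary_lower _ _ _ _ _ _ _ _ _ _ bdO ltE leE OSE.
    rewrite /= E0 EE => /(_ isT); rewrite -mE mulrAC ler_pM2r ?subr_gt0 //.
  have cy : c * (Eopt - E) <= c0 * (Smax - S).
    apply: le_trans (_ : c * (m * (Smax - S)) <= _); first by rewrite ler_pM2l.
    by rewrite mulrA ler_wpM2r.
  have ky : kappa * (Eopt - E) <= kappa * (m * (Smax - S)) by rewrite ler_pM2l.
  rewrite (ger0_norm y0); move: cx cy; rewrite /c0; split; lra.
have y0 : 0 <= E - Eopt by rewrite subr_ge0 ltW.
have cy : c * (E - Eopt) <= kappa * (E - Eopt) by rewrite ler_wpM2r.
have cx1 : c0 * (Smax - S) <= Smax - S by rewrite ler_piMl.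
have ky : 0 <= kappa * (E - Eopt) by rewrite mulr_ge0 // ltW.
rewrite distrC (ger0_norm y0); split; lra.
Qed.

(** Replace the second component of [x] by [p]: the period-1 terms cancel, the unweighted [S_2] term
    does not decrease, and the work term worsens by at most [lambda] since [W] takes values in
    [[0, 1]]. Optimality of [x] then caps the weighted gain. *)
Lemma maximizers_gap (R : realType) (O : set (R * R)) (W : R * R -> R)
    (lambda kappa gamma : R) (p : R * R) (x : (R * R) * (R * R)) :
  0 <= lambda -> (forall q, O q -> 0 <= W q <= 1) ->
  O p -> (forall q, O q -> q.1 <= p.1) ->
  maximizers O W lambda kappa gamma x ->
  gamma * ((p.1 - kappa * p.2) - (x.2.1 - kappa * x.2.2)) <= lambda.
Proof.
move=> l0 W01 Op pmax [[Ox1 Ox2]] /(_ (x.1, p) (conj Ox1 Op)).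
rewrite /objective /=; have := pmax _ Ox2.
have /andP[_ Wp] := W01 _ Op; have /andP[Wx _] := W01 _ Ox2.
have := mulr_ge0 l0 Wx; have : lambda * W p <= lambda by rewrite ler_piMr.
lra.
Qed.

Theorem proposition8 (R : realType) (O : set (R * R)) (W : R * R -> R)
  (Smin Smax S4 Emin Emax Eopt E3 : R)
  (Salpha Ealpha Somega Eomega : R)
  (m kappa lambda : R)
  (O_compact : compact O)
  (O_polygonal : polygonal_region O)
  (Smin_def : is_minimum [set p.1 | p in O] Smin)
  (Smax_def : is_maximum [set p.1 | p in O] Smax)
  (Emin_def : is_minimum [set p.2 | p in O] Emin)
  (Emax_def : is_maximum [set p.2 | p in O] Emax)
  (O_right : right_boundary O Emin Emax
     (chain4 (Smin, Emin) (Smax, Eopt) (Smax, E3) (S4, Emax)))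
  (ltSminmax : Smin < Smax)
  (ltS4max : S4 < Smax)
  (ltEminopt : Emin < Eopt)
  (leEopt3 : Eopt <= E3)
  (ltE3max : E3 < Emax)
  (W_range : forall p, O p -> 0 <= W p <= 1)
  (W_continuous : {within O, continuous W})
  (W_argmin : argmin_on O W = [set (Salpha, Ealpha); (Somega, Eomega)])
  (alpha_int : interior O (Salpha, Ealpha))
  (omega_int : interior O (Somega, Eomega))
  (ltSao : Salpha < Somega)
  (ltEao : Ealpha < Eomega)
  (m_def : m = (Eopt - Emin) / (Smax - Smin))
  (kappa_def : kappa = Num.min (Smin / Emax) ((Smax - Smin) / Emax))
  (kappa_gt0 : 0 < kappa)
  (kappa_lt : kappa < 1 / m)
  (lambda_ge0 : 0 <= lambda) :
  (forall gamma : R, 0 < gamma ->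
     [/\ is_minimum (S2_star O W lambda kappa gamma)
                    (inf (S2_star O W lambda kappa gamma)),
         is_maximum (S2_star O W lambda kappa gamma)
                    (sup (S2_star O W lambda kappa gamma)),
         is_minimum (E2_star O W lambda kappa gamma)
                    (inf (E2_star O W lambda kappa gamma)) &
         is_maximum (E2_star O W lambda kappa gamma)
                    (sup (E2_star O W lambda kappa gamma))]) /\
  [/\ inf (S2_star O W lambda kappa gamma) @[gamma --> +oo] --> Smax,
      sup (S2_star O W lambda kappa gamma) @[gamma --> +oo] --> Smax,
      inf (E2_star O W lambda kappa gamma) @[gamma --> +oo] --> Eopt &
      sup (E2_star O W lambda kappa gamma) @[gamma --> +oo] --> Eopt].
Proof.
have OSmax : O (Smax, Eopt).
  case: O_right => sub _; apply: sub; left; left; exists 1 => /=.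
    by rewrite in_itv /= ler01 lexx.
  by rewrite /line_path subrr !mul0r !add0r !mul1r.
have leEoptmax : Eopt <= Emax := ltW (le_lt_trans leEopt3 ltE3max).
have clOO : closed (O `*` O).
  by apply: compact_closed; [exact: norm_hausdorff|exact: compact_setX].
have OO0 : O `*` O !=set0 by exists ((Smax, Eopt), (Smax, Eopt)).
have maxc gamma : compact (maximizers O W lambda kappa gamma) /\
    maximizers O W lambda kappa gamma !=set0.
  apply: argmax_on_compact => //; first exact: compact_setX.
  exact: objective_continuous.
have cS : continuous (fun x : (R * R) * (R * R) => x.2.1).
  by move=> x; apply: cvg_comp; [exact: cvg_snd|exact: cvg_fst].
have cE : continuous (fun x : (R * R) * (R * R) => x.2.2).
  by move=> x; apply: cvg_comp; [exact: cvg_snd|exact: cvg_snd].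
(* Attainment serves twice: it is the first half of the claim, and it makes the extrema selections
   from the solution sets when passing to the limit. *)
have infS gamma := compact_image_inf _ _ _ _ (maxc gamma).1 (maxc gamma).2 cS.
have supS gamma := compact_image_sup _ _ _ _ (maxc gamma).1 (maxc gamma).2 cS.
have infE gamma := compact_image_inf _ _ _ _ (maxc gamma).1 (maxc gamma).2 cE.
have supE gamma := compact_image_sup _ _ _ _ (maxc gamma).1 (maxc gamma).2 cE.
split.
  by move=> gamma _; split; [exact: infS|exact: supS|exact: infE|exact: supE].
rewrite m_def in kappa_lt.
have [c c0 sharp] := sharp_maximum _ _ _ _ _ _ _ _ _ _ Smax_def Emin_def O_right
  ltSminmax ltEminopt leEoptmax kappa_gt0 kappa_lt.
have gap gamma x : maximizers O W lambda kappa gamma x ->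
    gamma * ((Smax - kappa * Eopt) - (x.2.1 - kappa * x.2.2)) <= lambda.
  apply: (maximizers_gap _ _ _ _ _ _ (Smax, Eopt)) => // q Oq.
  by apply: Smax_def.2; exists q.
(* Sharpness gives [c * |Smax - s| <=] loss, and [gamma] times the loss is at most [lambda]; hence
   the constant [lambda / c], independent of [gamma]. *)
have boundS gamma s : 0 < gamma -> S2_star O W lambda kappa gamma s ->
    gamma * `|Smax - s| <= lambda / c.
  move=> g0 [x xmax <-]; rewrite ler_pdivlMr // -mulrA (mulrC _ c).
  apply: le_trans (gap _ _ xmax); rewrite ler_pM2l //.
  by have [] := sharp x.2 xmax.1.2.
have boundE gamma e : 0 < gamma -> E2_star O W lambda kappa gamma e ->
    gamma * `|Eopt - e| <= lambda / c.
  move=> g0 [x xmax <-]; rewrite ler_pdivlMr // -mulrA (mulrC _ c).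
  apply: le_trans (gap _ _ xmax); rewrite ler_pM2l //.
  by have [] := sharp x.2 xmax.1.2.
split.
- by apply: cvg_pinfty_squeeze_inv boundS => gamma _; exact: (infS gamma).1.
- by apply: cvg_pinfty_squeeze_inv boundS => gamma _; exact: (supS gamma).1.
- by apply: cvg_pinfty_squeeze_inv boundE => gamma _; exact: (infE gamma).1.
- by apply: cvg_pinfty_squeeze_inv boundE => gamma _; exact: (supE gamma).1.
Qed.
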